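(* Let $L_1$ and $L_2$ be finite groups with compatible normal series \[1=L_{0;1}\trianglelefteq L_{1;1}\trianglelefteq\cdots\trianglelefteq L_{\ell;1}=L_1\quad\text{and}\quad 1=L_{0;2}\trianglelefteq L_{1;2}\trianglelefteq\cdots\trianglelefteq L_{\ell;2}=L_2.\] Suppose that for every $i$ with $2\le i\le \ell-1$ there exists an isomorphism $\sigma_i:L_{i;1}/L_{i-1;1}\to L_{i;2}/L_{i-1;2}$ such that, for each $\delta\in\{1,2\}$, writing $\bar\delta:=3-\delta$, \[(\sigma_i^{\bar\delta-\delta})_\bullet\bigl(\operatorname{Inn}(L_\delta/L_{i-1;\delta})^{L_{i;\delta}/L_{i-1;\delta}}\bigr)\le \operatorname{Aut}(L_{\bar\delta}/L_{i-1;\bar\delta})^{L_{i;\bar\delta}/L_{i-1;\bar\delta}}.\] Then $L_1$ and $L_2$ are compatible.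
   Context: Two finite groups $L_1,L_2$ are compatible if there exists a finite group $G$ with isomorphic normal subgroups $N_1\cong N_2$ such that $L_1\cong G/N_1$ and $L_2\cong G/N_2$. Normal series $1=L_{0;\delta}\trianglelefteq\cdots\trianglelefteq L_{\ell;\delta}=L_\delta$ ($\delta\in\{1,2\}$), in which every $L_{i;\delta}$ is normal in $L_\delta$, are compatible if they have the same length $\ell$ and $L_{i;1}/L_{i-1;1}\cong L_{i;2}/L_{i-1;2}$ for every $i\in\{1,\dots,\ell\}$. For an isomorphism $f:G_1\to G_2$, $f_\bullet:\operatorname{Aut}(G_1)\to\operatorname{Aut}(G_2)$ is the isomorphism $\sigma\mapsto f\circ\sigma\circ f^{-1}$. Here $\sigma_i^{\bar\delta-\delta}$ is $\sigma_i$ when $\delta=1$ and $\sigma_i^{-1}$ when $\delta=2$. For a group $G$, a subgroup $H\le G$ and $A\le\operatorname{Aut}(G)$, $A^H:=\{\sigma|_H\in\operatorname{Aut}(H)\mid \sigma\in A,\ \sigma(H)=H\}$. $\operatorname{Inn}(G)$ denotes the group of inner automorphisms of $G$. *)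

(* Defs.v *)
From HB Require Import structures.
From mathcomp Require Import all_boot all_fingroup.

Set Implicit Arguments.
Unset Strict Implicit.
Unset Printing Implicit Defensive.

Local Open Scope group_scope.

Definition compatible (gT1 gT2 : finGroupType)
    (L1 : {group gT1}) (L2 : {group gT2}) : Prop :=
  exists (gT : finGroupType) (G N1 N2 : {group gT}),
    [/\ N1 <| G, N2 <| G, N1 \isog N2, L1 \isog G / N1 & L2 \isog G / N2].

(* Only the terms [S 0], ..., [S l] are relevant; the values of [S] beyond
   [l] are unconstrained. *)
Definition normal_series (gT : finGroupType) (l : nat)
    (S : nat -> {group gT}) (L : {group gT}) : Prop :=
  [/\ S 0 = 1%G, S l = L,
      forall i, i < l -> S i <| S i.+1
    & forall i, i <= l -> S i <| L].

(* Two series of the same length [l]. *)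
Definition compatible_series (gT1 gT2 : finGroupType) (l : nat)
    (S1 : nat -> {group gT1}) (S2 : nat -> {group gT2}) : Prop :=
  forall i, 1 <= i <= l -> S1 i / S1 i.-1 \isog S2 i / S2 i.-1.

Definition Inn (gT : finGroupType) (G : {group gT}) : {set {perm gT}} :=
  conj_aut G @* G.

(* A^H. As elements of [Aut H] are permutations of the whole type fixing the
   complement of H, [s|_H] is represented by [restr_perm H s], which agrees
   with s on H and is the identity elsewhere. *)
Definition aut_restr (gT : finGroupType) (A : {set {perm gT}})
    (H : {set gT}) : {set {perm gT}} :=
  [set restr_perm H s | s in A & s @: H == H].

(* The map [s |-> f \o s \o f^-1] from [Aut D] to [Aut (f @* D)]; see
   [Aut_isomE]. *)
Definition bullet (aT rT : finGroupType) (D : {group aT})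
    (f : {morphism D >-> rT}) (injf : 'injm f) : {perm aT} -> {perm rT} :=
  Aut_isom injf (subxx D).

(* Main.v *)
(* By induction on the length, it suffices to treat L1, L2 with isomorphic
   normal subgroups A1, A2 such that L1 / A1 and L2 / A2 are compatible, say
   through epimorphisms f1, f2 from G with isomorphic kernels M1, M2.  In the
   regular representation of G, inside K = Sym(G), these kernels are conjugate
   by some t.  Let P be the pullback of L1 x L2 along (f1, f2), an extension of
   G by A1 x A2, and induce it to an extension E of K by a power of A1 x A2.
   The preimage H of G in E still maps onto P, hence onto L1 and L2, and the
   preimages U1, U2 of M1, M2 are conjugate in E by a lift of t.  Moreover
   U1 = N1 x A1 and U2 = N2 x A2, where N1, N2 are the kernels of the maps from
   H to L1, L2.  So H x A1 maps onto L1 and L2 with kernels N1 x A1 = U1 and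
   N2 x A1, isomorphic to U2. *)
From HB Require Import structures.
Require Import Defs.
From mathcomp Require Import all_boot all_fingroup.

Set Implicit Arguments.
Unset Strict Implicit.
Unset Printing Implicit Defensive.

Local Open Scope group_scope.

(** * Inducing a group extension from a subgroup to the whole group *)

Section InducedExtension.
Variables kT pT : finGroupType.

(** Carrier of the semidirect product of the functions on subsets of [kT] with [kT], which acts by
    right translation. Indexing by all subsets instead of cosets keeps the type independent of
    [G]. *)
Definition wreath : Type := ({ffun {set kT} -> pT} * kT)%type.
HB.instance Definition _ := Finite.on wreath.

Implicit Types x y : wreath.

Definition wr_one : wreath := ([ffun => 1], 1).
Definition wr_mul x y : wreath :=
  ([ffun w : {set kT} => x.1 w * y.1 (w :* x.2)], x.2 * y.2).
Definition wr_inv x : wreath :=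
  ([ffun w : {set kT} => (x.1 (w :* x.2^-1))^-1], x.2^-1).

Lemma wr_mulA : associative wr_mul.
Proof.
move=> x y z; congr pair; last exact: mulgA.
by apply/ffunP=> w; rewrite !ffunE /= rcosetM mulgA.
Qed.

Lemma wr_mul1 : left_id wr_one wr_mul.
Proof.
case=> f s; congr pair; last exact: mul1g.
by apply/ffunP=> w; rewrite !ffunE /= rcoset1 mul1g.
Qed.

Lemma wr_mulV : left_inverse wr_one wr_inv wr_mul.
Proof.
case=> f s; congr pair; last exact: mulVg.
by apply/ffunP=> w; rewrite !ffunE /= mulVg.
Qed.

HB.instance Definition _ := Finite_isGroup.Build wreath wr_mulA wr_mul1 wr_mulV.

Lemma wr_fstM x y w : (x * y).1 w = x.1 w * y.1 (w :* x.2).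
Proof. by rewrite ffunE. Qed.

Lemma wr_fst1 w : (1 : wreath).1 w = 1.
Proof. by rewrite ffunE. Qed.

Variables (G : {group kT}) (P : {group kT * pT}).

(** The Schreier cocycle of the transversal [repr]. *)
Definition transfer (w : {set kT}) (s : kT) := repr w * s * (repr (w :* s))^-1.

Lemma transferM w s s' : transfer w (s * s') = transfer w s * transfer (w :* s) s'.
Proof. by rewrite /transfer rcosetM !mulgA mulgKV. Qed.

Lemma transfer1 w : transfer w 1 = 1.
Proof. by rewrite /transfer rcoset1 mulg1 mulgV. Qed.

Lemma transfer_group w s : w \in rcosets G setT -> transfer w s \in G.
Proof.
case/rcosetsP=> a _ ->; rewrite /transfer -rcosetM.
case: repr_rcosetP => x Gx; case: repr_rcosetP => y Gy.
by rewrite -mulgA !invMg !mulgA !mulgK groupM ?groupV.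
Qed.

(** [repr] selects 1 in a group, so [s] is its own component at the base coset. *)
Lemma transferG s : s \in G -> transfer G s = s.
Proof.
by move=> Gs; rewrite /transfer rcoset_id // repr_group mul1g invg1 mulg1.
Qed.

Lemma base_rcoset : gval G \in rcosets G setT.
Proof. by apply/rcosetsP; exists 1; rewrite ?inE ?rcoset1. Qed.

Lemma rcosets_mem w s : w \in rcosets G setT -> w :* s \in rcosets G setT.
Proof.
case/rcosetsP=> a _ ->; rewrite -rcosetM.
by apply/rcosetsP; exists (a * s); rewrite ?inE.
Qed.

(* P is seen as an extension of its projection G on kT; an element (f, s) of
   the induced extension of kT lifts the components of the image of s under
   the monomial embedding of kT into G wr Sym(kT / G).  The values of f outside
   the cosets of G are unconstrained. *)
Definition induced : {set wreath} :=
  [set x : wreath | [forall w in rcosets G setT, (transfer w x.2, x.1 w) \in P]].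

Lemma inducedP x :
  reflect {in rcosets G setT, forall w, (transfer w x.2, x.1 w) \in P}
          (x \in induced).
Proof. by rewrite inE; apply: forall_inP. Qed.

Lemma induced_group_set : group_set induced.
Proof.
apply/group_setP; split=> [|x y /inducedP Ex /inducedP Ey].
  by apply/inducedP=> w _; rewrite wr_fst1 transfer1 group1.
apply/inducedP=> w Gw; rewrite wr_fstM transferM.
exact: (groupM (Ex w Gw) (Ey _ (rcosets_mem _ Gw))).
Qed.
Canonical induced_group := Group induced_group_set.

Definition wr_proj (x : wreath) : kT := x.2.
Lemma wr_projM : {in setT &, {morph wr_proj : x y / x * y}}. Proof. by []. Qed.
Canonical wr_proj_morphism := Morphism wr_projM.

Definition induced_preimage (M : {set kT}) : {set wreath} :=
  induced :&: wr_proj @*^-1 M.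
Canonical preimage_group (M : {group kT}) := [group of induced_preimage M].

Lemma preimageE M x : (x \in induced_preimage M) = (x \in induced) && (x.2 \in M).
Proof. by rewrite in_setI !inE. Qed.

Lemma preimage_conj M x :
  x \in induced -> induced_preimage M :^ x = induced_preimage (M :^ x.2).
Proof.
move=> Ex; apply/setP=> y; rewrite mem_conjg !preimageE mem_conjg.
by rewrite groupJr // groupV.
Qed.

Hypothesis defG : [morphism of @fst kT pT] @* P = G.

Lemma induced_lift s p :
  (transfer G s, p) \in P -> exists2 x, x \in induced & x.1 G = p /\ x.2 = s.
Proof.
move=> Psp.
(* Only the coordinate at [G] is prescribed. At any other coset an arbitrary lift serves, and one
   exists because [P] projects onto [G]; the default 1 can occur only off the cosets. *)
pose f := [ffun w : {set kT} => if w == G then p else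
             odflt 1 [pick q | (transfer w s, q) \in P]].
exists (f, s); last by rewrite /= ffunE eqxx.
apply/inducedP=> w Gw /=; rewrite ffunE; case: eqP => [-> // | _].
case: pickP => //= noq; have := transfer_group s Gw.
by rewrite -{1}defG => /morphimP[[a q] _ Paq /= def_a]; rewrite -def_a noq in Paq.
Qed.

Lemma induced_proj s : exists2 x, x \in induced & x.2 = s.
Proof.
have := transfer_group s base_rcoset.
rewrite -{2}defG => /morphimP[[a q] _ Paq /= def_a].
by case: (@induced_lift s q) => [|x Ex [_ <-]]; [rewrite def_a | exists x].
Qed.

(** A lift of [s] conjugates one preimage onto the other. Such a lift exists even for [s] outside
    [G], which is the purpose of the induced extension. *)
Lemma preimage_isog (M1 M2 : {group kT}) s :
  M1 :^ s = M2 -> induced_preimage M1 \isog induced_preimage M2.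
Proof.
by move <-; have [x Ex <-] := induced_proj s; rewrite -preimage_conj ?conj_isog.
Qed.

Definition wr_eval (x : wreath) : kT * pT := (x.2, x.1 G).
(** Elements over [G] fix the base coset, so their coordinates at [G] multiply without a shift. *)
Lemma wr_evalM : {in induced_preimage G &, {morph wr_eval : x y / x * y}}.
Proof.
move=> x y; rewrite !preimageE => /andP[_ Gx] _.
by rewrite /wr_eval wr_fstM (rcoset_id Gx).
Qed.
Canonical wr_eval_morphism := Morphism wr_evalM.

Lemma wr_eval_im : wr_eval @* induced_preimage G = P.
Proof.
apply/setP=> [[s p]]; apply/morphimP/idP=> [[x _] | Psp].
  rewrite preimageE => /andP[/inducedP/(_ G base_rcoset) + Gx] ->.
  by rewrite transferG.
have Gs : s \in G by rewrite -defG; apply/morphimP; exists (s, p); rewrite ?inE.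
have [|x Ex [xp xs]] := @induced_lift s p; first by rewrite transferG.
by exists x; rewrite ?preimageE ?Ex ?xs //= /wr_eval xs xp.
Qed.

Definition wr_base (p : pT) : wreath :=
  ([ffun w : {set kT} => if w == G then p else 1], 1).
Lemma wr_baseM : {in setT &, {morph wr_base : p q / p * q}}.
Proof.
move=> p q _ _; congr pair; last by rewrite /= mulg1.
by apply/ffunP=> w; rewrite !ffunE /= rcoset1; case: eqP; rewrite ?mulg1.
Qed.

Lemma wr_base_preimage p : (1, p) \in P -> wr_base p \in induced_preimage G.
Proof.
move=> Pp; rewrite preimageE group1 andbT; apply/inducedP=> w Gw /=.
by rewrite transfer1 ffunE; case: eqP => // _; apply: group1.
Qed.

(** [wr_base p] is supported at the base coset, which [x] fixes, so only the coordinate at [G] has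
    to be compared. *)
Lemma wr_base_commute x p :
  x \in induced_preimage G -> commute (wr_eval x) (1, p) -> commute x (wr_base p).
Proof.
rewrite preimageE => /andP[_ Gx] [_ cxp].
congr pair; last by rewrite /= mulg1 mul1g.
have nG w : (w :* x.2 == G) = (w == G).
  by rewrite -{1}(rcoset_id Gx) (inj_eq (can_inj (rcosetK _))).
apply/ffunP=> w; rewrite !ffunE /= rcoset1 nG.
by case: eqP => [-> | _]; rewrite ?mulg1 ?mul1g.
Qed.

End InducedExtension.

(** * Compatibility in terms of epimorphisms *)

Lemma isog_quotient_morphism (gT rT : finGroupType) (G N : {group gT})
    (L : {group rT}) :
  N <| G -> L \isog G / N ->
  exists f : {morphism G >-> rT}, f @* G = L /\ 'ker f = N.
Proof.
move=> nNG; rewrite isog_sym => /isogP[g injg <-].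
(* The composite lives on a preimage under [coset N]; [domP] recasts it as a morphism with domain
   [G]. *)
have dom_gc : 'dom [morphism of g \o coset N] = G.
  by rewrite /dom /= quotientGK.
have [f [_ ker_f _ im_f]] := domP [morphism of g \o coset N] dom_gc.
exists f; split; first by rewrite im_f morphim_comp.
by rewrite ker_f ker_comp ker_injm // -kerE ker_coset.
Qed.

Lemma compatibleP (gT1 gT2 gT : finGroupType) (G : {group gT})
    (L1 : {group gT1}) (L2 : {group gT2})
    (f1 : {morphism G >-> gT1}) (f2 : {morphism G >-> gT2}) :
  f1 @* G = L1 -> f2 @* G = L2 -> 'ker f1 \isog 'ker f2 -> compatible L1 L2.
Proof.
move=> im1 im2 iso; exists gT, G, ('ker f1)%G, ('ker f2)%G.
by split; rewrite ?ker_normal // isog_sym -?im1 -?im2 first_isog.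
Qed.

(** * Conjugacy of isomorphic subgroups in the regular representation *)

Lemma injm_regular (gT : finGroupType) : 'injm (actperm 'R : gT -> {perm gT}).
Proof.
apply/injmP=> x y _ _ /permP/(_ 1); rewrite !actpermE /=.
by rewrite !mul1g.
Qed.

(** Elements are matched by their positions in the two enumerations. This serves to pair the cosets
    of two subgroups of equal order. *)
Lemma eq_card_injection (T : finType) (A B : {set T}) :
  #|A| = #|B| ->
  exists2 F : T -> T, {in A &, injective F} & {in A, forall x, F x \in B}.
Proof.
move=> eqAB; pose i x := index x (enum A).
have ltiB x : x \in A -> i x < size (enum B).
  by move=> Ax; rewrite -cardE -eqAB cardE index_mem mem_enum.
exists (fun x => nth x (enum B) (i x)) => [x y Ax Ay | x Ax]; last first.
  by rewrite -mem_enum mem_nth ?ltiB.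
rewrite (set_nth_default x y) ?ltiB // => /eqP.
rewrite nth_uniq ?ltiB ?enum_uniq // => /eqP eq_i.
rewrite -[x](@nth_index _ x _ (enum A)) ?mem_enum // [index x _]eq_i.
by rewrite nth_index ?mem_enum.
Qed.

(** Both subgroups act freely by right multiplication, with equally many orbits, the left cosets. A
    matching of orbits therefore extends to a permutation intertwining the actions through [h]. *)
Lemma regular_conj (gT : finGroupType) (M1 M2 : {group gT}) :
  M1 \isog M2 ->
  exists t : {perm gT}, (actperm 'R @* M1) :^ t = actperm 'R @* M2.
Proof.
move=> isoM; have oM := card_isog isoM.
case/isogP: (isoM) => h injh im_h.
have [|F injF FB] :=
  @eq_card_injection _ (lcosets M1 [set: gT]) (lcosets M2 [set: gT]).
  by rewrite !card_lcosets -!divgS ?subsetT // oM.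
have h_inM2 m : m \in M1 -> h m \in M2 by move=> Mm; rewrite -im_h mem_morphim.
(* Each coset representative goes to the representative of the matched coset; [h] extends this
   equivariantly along the coset. *)
pose t x := repr (F (x *: M1)) * h ((repr (x *: M1))^-1 * x).
have rM x : (repr (x *: M1))^-1 * x \in M1.
  by rewrite -mem_lcoset lcoset_sym (mem_repr _ (lcoset_refl _ _)).
have lcM1 x : x *: M1 \in lcosets M1 [set: gT].
  by apply/lcosetsP; exists x; rewrite ?inE.
have Ft x : F (x *: M1) = t x *: M2.
  have /lcosetsP[y _ Fy] := FB _ (lcM1 x).
  rewrite Fy; apply/esym/lcoset_eqP; rewrite /t Fy mem_lcoset mulgA.
  by rewrite groupM ?h_inM2 // -mem_lcoset (mem_repr _ (lcoset_refl _ _)).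
have injt : injective t.
  move=> x y eq_t; have eq_xy : x *: M1 = y *: M1.
    by apply: injF; rewrite // !Ft eq_t.
  move: eq_t; rewrite /t eq_xy => /mulgI/(injmP injh) eq_h.
  apply: (mulgI (repr (y *: M1))^-1).
  by rewrite eq_h -?eq_xy // eq_xy.
have tM x m : m \in M1 -> t (x * m) = t x * h m.
  by move=> Mm; rewrite /t lcosetM lcoset_id // mulgA morphM ?rM // mulgA.
exists (perm injt); rewrite -im_h morphimEdom [LHS]/conjugate.
rewrite !morphimEsub ?subsetT //=.
rewrite -!imset_comp; apply: eq_in_imset => m Mm /=.
(* At [y] the conjugate has value [t (t^-1 y * m)], which is [y * h m] by [tM]. *)
apply/permP=> y; rewrite conjgE !permM actpermE permE /=.
by rewrite actpermE /= tM // -[X in X * _](permE injt) permKV.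
Qed.

Lemma compatible_conj (gT1 gT2 : finGroupType) (L1 : {group gT1})
    (L2 : {group gT2}) :
  compatible L1 L2 ->
  exists (kT : finGroupType) (G : {group kT})
         (f1 : {morphism G >-> gT1}) (f2 : {morphism G >-> gT2}) (t : kT),
    [/\ f1 @* G = L1, f2 @* G = L2 & 'ker f1 :^ t = 'ker f2].
Proof.
case=> gT [G [N1 [N2 [nN1 nN2 isoN iso1 iso2]]]].
have [f1 [im1 ker1]] := isog_quotient_morphism nN1 iso1.
have [f2 [im2 ker2]] := isog_quotient_morphism nN2 iso2.
have [t conjN] := regular_conj isoN.
(* [ifactm] transports [f1] and [f2] to the regular image of [G], so their kernels become the images
   of [N1] and [N2]. *)
exists {perm gT}, (actperm 'R @* G)%G, (ifactm f1 (injm_regular gT)),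
  (ifactm f2 (injm_regular gT)), t.
by rewrite !im_ifactm ?subsetT // !ker_ifactm ker1 ker2.
Qed.

(** * Direct decompositions of preimages and kernels *)

(** [k] is a section of [q] over [A] whose image centralizes the kernel, so each [x] in the preimage
    factors as [x * (k (q x))^-1] times [k (q x)]. *)
Lemma ker_dprod_section (wT lT : finGroupType) (H : {group wT}) (A : {group lT})
    (q : {morphism H >-> lT}) (k : {morphism A >-> wT}) :
  {in A, forall a, k a \in H /\ q (k a) = a} ->
  {in 'ker q & A, forall n a, commute n (k a)} ->
  'ker q \x k @* A = q @*^-1 A.
Proof.
move=> kP cqk.
have sKH : k @* A \subset H.
  by apply/subsetP=> _ /morphimP[a _ Aa ->]; case: (kP a Aa).
rewrite dprodE.
- apply/setP=> x; apply/imset2P/morphpreP.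
    case=> n _ Kn /morphimP[a _ Aa ->] ->.
    have [Hk qk] := kP a Aa; have Hn := dom_ker Kn.
    by rewrite groupM // morphM // (mker Kn) mul1g qk.
  move=> [Hx Aqx]; have [Hk qk] := kP _ Aqx.
  exists (x * (k (q x))^-1) (k (q x)); rewrite ?mulgKV ?mem_morphim //.
  by apply/kerP; rewrite ?groupM ?groupV // morphM ?groupV // morphV // qk mulgV.
- apply/centsP=> _ /morphimP[a _ Aa ->] n Kn; exact/commute_sym/cqk.
apply/trivgP/subsetP=> x /setIP[Kx /morphimP[a _ Aa def_x]].
rewrite {x}def_x in Kx *.
have [_] := kP a Aa; rewrite (mker Kx) => <-.
by rewrite morph1.
Qed.

(** The projection [r] and embedding [j] are abstract so that the lemma serves both factors of the
    pullback. The complement [C] is the copy of [A] placed at the base coset. *)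
Lemma preimage_ker_dprod (kT pT lT : finGroupType) (G : {group kT})
    (P : {group kT * pT})
    (L A : {group lT}) (f : {morphism G >-> coset_of A})
    (r : {morphism [set: pT] >-> lT}) (j : {morphism [set: lT] >-> pT}) :
  [morphism of @fst kT pT] @* P = G -> A <| L ->
  {in P, forall x, r x.2 \in L /\ f x.1 = coset A (r x.2)} ->
  {in L, forall l, exists2 x, x \in P & r x.2 = l} ->
  {in A, forall a, (1, j a) \in P /\ r (j a) = a} ->
  (forall p a, r p = 1 -> commute p (j a)) ->
  exists q : {morphism induced_preimage G P G >-> lT},
  q @* induced_preimage G P G = L /\
  exists2 C : {group wreath kT pT},
    'ker q \x C = induced_preimage G P ('ker f) & C \isog A.
Proof.
move=> defG nAL rP rL jA cj; have im_e := wr_eval_im defG.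
have eP x : x \in induced_preimage G P G -> wr_eval G x \in P.
  by move=> Hx; rewrite -im_e mem_morphim.
have qM : {in induced_preimage G P G &,
    {morph (fun x => r (wr_eval G x).2) : x y / x * y}}.
  by move=> x y Hx Hy; rewrite (wr_evalM Hx Hy) morphM ?inE.
pose q := Morphism qM.
have im_q : q @* induced_preimage G P G = L.
  apply/setP=> l; apply/morphimP/idP=> [[x _ Hx ->] | Ll].
    by case: (rP _ (eP x Hx)).
  have [y Py <-] := rL l Ll; move: Py; rewrite -im_e => /morphimP[x _ Hx ->].
  by exists x.
exists q; split=> //.
have kM : {in A &, {morph (fun a => wr_base G (j a)) : a b / a * b}}.
  by move=> a b _ _; rewrite morphM ?inE // (wr_baseM G) ?inE.
pose k := Morphism kM.
have kP : {in A, forall a, k a \in induced_preimage G P G /\ q (k a) = a}.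
  move=> a Aa; have [Pj rj] := jA a Aa; split; first exact: wr_base_preimage.
  by rewrite /q /k /= ffunE eqxx.
exists (k @* A)%G.
  rewrite /= ker_dprod_section // => [|n a Kn Aa].
    (* By [rP], [x] lies over ['ker f] exactly when the coset of [q x] is trivial, that is, when
       [q x] is in [A]. *)
    apply/setP=> x; rewrite [LHS]in_setI [RHS]preimageE [x.2 \in _]in_setI.
    rewrite andbA -preimageE.
    apply: andb_id2l => Hx; have [Lr fr] := rP _ (eP x Hx).
    rewrite !inE /q /= in Lr fr *; rewrite fr.
    apply/idP/eqP=> [|r1]; first exact: coset_id.
    by rewrite (coset_idr _ r1) // (subsetP (normal_norm nAL)).
  have Hn := dom_ker Kn.
  apply: (wr_base_commute Hn); congr pair; first by rewrite mulg1 mul1g.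
  by apply: cj; apply: (mker Kn).
rewrite isog_sym sub_isog //; apply/injmP=> a b Aa Ab eq_k.
by have [[_ <-] [_ <-]] := (kP a Aa, kP b Ab); rewrite eq_k.
Qed.

Lemma isog_setX_dprod (wT lT : finGroupType) (K C U : {group wT}) (D : {group lT}) :
  K \x C = U -> C \isog D -> setX K D \isog U.
Proof.
move=> dU isoC; apply: isog_dprod (setX_dprod K D) dU _ _.
  by rewrite isog_sym /= -(morphim_pairg1 lT) sub_isog ?subsetT ?injm_pairg1.
rewrite (isog_transr _ isoC) isog_sym /= -(morphim_pair1g wT) sub_isog ?subsetT //.
exact: injm_pair1g.
Qed.

Lemma compatible_dprod (gT1 gT2 wT : finGroupType) (L1 : {group gT1})
    (L2 : {group gT2}) (H C1 C2 U1 U2 : {group wT})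
    (q1 : {morphism H >-> gT1}) (q2 : {morphism H >-> gT2}) :
  q1 @* H = L1 -> q2 @* H = L2 -> 'ker q1 \x C1 = U1 -> 'ker q2 \x C2 = U2 ->
  C1 \isog C2 -> U1 \isog U2 -> compatible L1 L2.
Proof.
move=> im1 im2 dU1 dU2 isoC isoU.
(* Composing with the first projection of [setX H C1] keeps the image and multiplies the kernel by
   [C1]. *)
have ext (rT : finGroupType) (q : {morphism H >-> rT}) :
    exists2 p : {morphism setX H C1 >-> rT},
      p @* setX H C1 = q @* H & 'ker p = setX ('ker q) C1.
  have pM : {in setX H C1 &, {morph (fun x => q x.1) : x y / x * y}}.
    by move=> x y; rewrite !inE => /andP[Hx _] /andP[Hy _]; rewrite morphM.
  exists (Morphism pM).
    apply/setP=> l; apply/morphimP/morphimP=> [[x _]|[h _ Hh ->]].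
      by rewrite inE => /andP[Hx _] ->; exists x.1.
    by exists (h, 1); rewrite // inE Hh group1.
  by apply/setP=> x; rewrite !inE -!andbA; congr (_ && _); rewrite andbC.
have [p1 imp1 kerp1] := ext _ q1; have [p2 imp2 kerp2] := ext _ q2.
apply: (@compatibleP _ _ _ _ _ _ p1 p2); rewrite ?imp1 ?imp2 //.
(* The first kernel is isomorphic to [U1] directly, the second to [U2] after exchanging [C2] for
   [C1]. *)
rewrite kerp1 kerp2 (isog_transl _ (isog_setX_dprod dU1 (isog_refl _))).
by rewrite (isog_transl _ isoU) isog_sym (isog_setX_dprod dU2) // isog_sym.
Qed.

(** * Lifting compatibility through isomorphic normal subgroups *)

Lemma compatible_extension (gT1 gT2 : finGroupType) (L1 A1 : {group gT1})
    (L2 A2 : {group gT2}) :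
  A1 <| L1 -> A2 <| L2 -> A1 \isog A2 -> compatible (L1 / A1) (L2 / A2) ->
  compatible L1 L2.
Proof.
move=> nA1 nA2 isoA /compatible_conj[kT [G [f1 [f2 [t [im1 im2 conj_ker]]]]]].
have sLN1 := normal_norm nA1; have sLN2 := normal_norm nA2.
(* The pullback: an element of [G] together with lifts of its two images to [L1] and [L2]. *)
pose P := [set x : kT * (gT1 * gT2) | [&& x.1 \in G, x.2.1 \in L1, x.2.2 \in L2,
   f1 x.1 == coset A1 x.2.1 & f2 x.1 == coset A2 x.2.2]].
have gP : group_set P.
  apply/group_setP; split=> [|[x [x1 x2]] [y [y1 y2]]]; rewrite !inE /=.
    by rewrite !group1 !morph1 !eqxx.
  case/and5P=> Gx Lx1 Lx2 /eqP e1 /eqP e2 /and5P[Gy Ly1 Ly2 /eqP e3 /eqP e4].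
  rewrite !groupM //= !morphM ?(subsetP sLN1) ?(subsetP sLN2) //.
  by rewrite e1 e2 e3 e4 !eqxx.
pose PG := Group gP.
have lift1 g : g \in G -> exists2 l, l \in L1 & f1 g = coset A1 l.
  move=> Gg; have : f1 g \in L1 / A1 by rewrite -im1 mem_morphim.
  by case/morphimP=> l _ Ll ->; exists l.
have lift2 g : g \in G -> exists2 l, l \in L2 & f2 g = coset A2 l.
  move=> Gg; have : f2 g \in L2 / A2 by rewrite -im2 mem_morphim.
  by case/morphimP=> l _ Ll ->; exists l.
have inPG x : (x \in PG) = [&& x.1 \in G, x.2.1 \in L1, x.2.2 \in L2,
   f1 x.1 == coset A1 x.2.1 & f2 x.1 == coset A2 x.2.2] by rewrite inE.
have defG : [morphism of @fst kT (gT1 * gT2)%type] @* PG = G.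
  apply/setP=> g; apply/morphimP/idP=> [[x _] | Gg].
    by rewrite inPG => /andP[Gx _] ->.
  have [[l1 Ll1 e1] [l2 Ll2 e2]] := (lift1 g Gg, lift2 g Gg).
  by exists (g, (l1, l2)); rewrite ?inPG ?inE //= Gg Ll1 Ll2 e1 e2 !eqxx.
have onto1 l : l \in L1 -> exists2 x, x \in PG & x.2.1 = l.
  move=> Ll; have : coset A1 l \in f1 @* G by rewrite im1 mem_quotient.
  case/morphimP=> g _ Gg e1; have [l2 Ll2 e2] := lift2 g Gg.
  by exists (g, (l, l2)); rewrite // inPG /= Gg Ll Ll2 -e1 e2 !eqxx.
have onto2 l : l \in L2 -> exists2 x, x \in PG & x.2.2 = l.
  move=> Ll; have : coset A2 l \in f2 @* G by rewrite im2 mem_quotient.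
  case/morphimP=> g _ Gg e2; have [l1 Ll1 e1] := lift1 g Gg.
  by exists (g, (l1, l)); rewrite // inPG /= Gg Ll Ll1 -e2 e1 !eqxx.
(* Here [r] is the first projection and [j] the first embedding; an element of the pullback fiber
   killed by [r] commutes with the image of [j]. *)
have [|||q1 [im_q1 [C1 dC1 isoC1]]] := @preimage_ker_dprod _ _ _ _ _ _ _ f1
    (fst_morphism gT1 gT2) (pairg1_morphism gT1 gT2) defG nA1 _ onto1.
- by move=> x; rewrite inPG => /and5P[_ ? _ /eqP ? _].
- move=> a Aa; rewrite inPG /= !group1 !morph1 (subsetP (normal_sub nA1)) //.
  by rewrite coset_id // !eqxx.
- by move=> [p1 p2] a /= ->; congr pair; rewrite ?mulg1 ?mul1g.
have [|||q2 [im_q2 [C2 dC2 isoC2]]] := @preimage_ker_dprod _ _ _ _ _ _ _ f2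
    (snd_morphism gT1 gT2) (pair1g_morphism gT1 gT2) defG nA2 _ onto2.
- by move=> x; rewrite inPG => /and5P[_ _ ? _ /eqP ?].
- move=> a Aa; rewrite inPG /= !group1 !morph1 (subsetP (normal_sub nA2)) //.
  by rewrite coset_id // !eqxx.
- by move=> [p1 p2] a /= ->; congr pair; rewrite ?mulg1 ?mul1g.
apply: (compatible_dprod im_q1 im_q2 dC1 dC2).
  by rewrite (isog_transl _ isoC1) (isog_transl _ isoA) isog_sym.
(* The two direct products are the preimages of kernels conjugate under [t]. *)
exact: (preimage_isog defG conj_ker).
Qed.

(** * Induction along the normal series *)

Lemma normal_series_first (gT : finGroupType) l (S : nat -> {group gT}) L i :
  normal_series l.+1 S L -> i < l.+1 -> S 1%N <| S i.+1.
Proof.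
case=> S0 _ nSS nSL ltil; have sub : S 1%N \subset S i.+1.
  elim: i ltil => // i IHi ltil.
  exact: subset_trans (IHi (ltnW ltil)) (normal_sub (nSS _ ltil)).
exact: normalS sub (normal_sub (nSL _ ltil)) (nSL 1%N isT).
Qed.

Lemma normal_series_quotient (gT : finGroupType) l (S : nat -> {group gT}) L :
  normal_series l.+1 S L ->
  normal_series l (fun i => S i.+1 / S 1%N)%G (L / S 1%N)%G.
Proof.
case=> S0 <- nSS nSL; split=> // [|i ltil|i leil].
- by apply: val_inj; rewrite /= trivg_quotient.
- exact: quotient_normal (nSS _ _).
- exact: quotient_normal (nSL _ _).
Qed.

Lemma compatible_of_series (gT1 gT2 : finGroupType) l (L1 : {group gT1})
    (L2 : {group gT2}) (S1 : nat -> {group gT1}) (S2 : nat -> {group gT2}) :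
  normal_series l S1 L1 -> normal_series l S2 L2 -> compatible_series l S1 S2 ->
  compatible L1 L2.
Proof.
elim: l => [|l IHl] in gT1 gT2 L1 L2 S1 S2 *.
  case=> S10 <- _ _ [S20 <- _ _] _; rewrite S10 S20.
  apply: (@compatibleP _ _ gT1 1 1 1 (triv_morph gT1 _) (triv_morph gT2 _)).
  - exact: morphim_trivm.
  - exact: morphim_trivm.
  by rewrite !ker_trivm isog_refl.
move=> nS1 nS2 isoS; have [S10 _ _ nSL1] := nS1; have [S20 _ _ nSL2] := nS2.
apply: (@compatible_extension _ _ L1 (S1 1%N) L2 (S2 1%N)); rewrite ?nSL1 ?nSL2 //.
  (* The bottom terms are isomorphic because they are the first factors, up to division by the
     trivial term at index 0. *)
  have := isoS 1%N isT; rewrite /= S10 S20 => iso1.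
  apply: isog_trans (quotient1_isog _) (isog_trans iso1 _).
  by rewrite isog_sym quotient1_isog.
apply: (IHl _ _ _ _ _ _ (normal_series_quotient nS1) (normal_series_quotient nS2)).
case=> // i /= ltil.
(* By the third isomorphism theorem, the factors of the quotient series are those of the original
   one, one index higher. *)
have third (gT : finGroupType) (S : nat -> {group gT}) L :
    normal_series l.+1 S L ->
    (S i.+2 / S 1%N) / (S i.+1 / S 1%N) \isog S i.+2 / S i.+1.
  move=> nS; have [_ _ nSS _] := nS; apply: third_isog.
  - exact: normal_sub (normal_series_first nS (ltnW ltil)).
  - by apply: (normal_series_first nS); rewrite ltnS.
  - exact: nSS.
apply: isog_trans (third _ _ _ nS1) (isog_trans (isoS i.+2 ltil) _).
by rewrite isog_sym; apply: third nS2.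
Qed.

Theorem corollary6p23 (gT1 gT2 : finGroupType)
    (L1 : {group gT1}) (L2 : {group gT2}) (l : nat)
    (S1 : nat -> {group gT1}) (S2 : nat -> {group gT2}) :
  normal_series l S1 L1 ->
  normal_series l S2 L2 ->
  compatible_series l S1 S2 ->
  (forall i : nat, 2 <= i <= l.-1 ->
     exists (sigma : {morphism (S1 i / S1 i.-1) >-> coset_of (S2 i.-1)})
            (iso : isom (S1 i / S1 i.-1) (S2 i / S2 i.-1) sigma),
       (bullet (isom_inj iso)
          @: aut_restr (Inn (L1 / S1 i.-1)) (S1 i / S1 i.-1)
        \subset aut_restr (Aut (L2 / S2 i.-1)) (S2 i / S2 i.-1)) /\
       (bullet (injm_invm (isom_inj iso))
          @: aut_restr (Inn (L2 / S2 i.-1)) (S2 i / S2 i.-1)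
        \subset aut_restr (Aut (L1 / S1 i.-1)) (S1 i / S1 i.-1))) ->
  compatible L1 L2.
Proof. by move=> nS1 nS2 isoS _; apply: compatible_of_series nS1 nS2 isoS. Qed.
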